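(* Let $(X,d)$ be a complete $\mathrm{CAT}(0)$ space that is additionally $\delta$-hyperbolic for some $\delta\ge 0$, and let $A\subseteq X$ be nonempty, closed and convex. Then the following statements are equivalent: (i) $A$ is geodesically bounded; (ii) $A$ is directionally bounded; (iii) $A$ has the approximate fixed point property (for nonexpansive mappings); (iv) $A$ has the fixed point property (for nonexpansive mappings); (v) the lion always wins the Lion-Man game played in $A$.
   Context: A geodesic joining $x$ and $y$ in a metric space $(X,d)$ is a map $\gamma:[a,b]\to X$ with $\gamma(a)=x$, $\gamma(b)=y$ and $d(\gamma(s),\gamma(t))=|s-t|$ for all $s,t\in[a,b]$; its image is a geodesic segment. $X$ is a (uniquely) geodesic space if every two points are joined by a (unique) geodesic segment, denoted $[x,y]$. A subset $A$ of a geodesic space is convex if every geodesic segment joining two points of $A$ is contained in $A$. A $\mathrm{CAT}(0)$ space is a geodesic space in which every geodesic triangle satisfies the $\mathrm{CAT}(0)$ inequality (distances between points on the triangle are at most the distances between the corresponding comparison points in a comparison triangle in $\mathbb{R}^2$); such spaces are uniquely geodesic. A geodesic space is $\delta$-hyperbolic if every side of every geodesic triangle is contained in the $\delta$-neighborhood of the union of the other two sides. A geodesic ray is (the image of) a map $\gamma:[0,\infty)\to X$ with $d(\gamma(s),\gamma(t))=|s-t|$ for all $s,t\ge 0$. A set is geodesically bounded if it contains no geodesic ray. A curve $\gamma:[0,\infty)\to X$ is directional if there is $b\ge 0$ with $|s-t|-b\le d(\gamma(s),\gamma(t))\le |s-t|$ for all $s,t\ge 0$. A set is directionally bounded if it contains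 no directional curve. A map $T:A\to A$ is nonexpansive if $d(Tx,Ty)\le d(x,y)$ for all $x,y\in A$. $A$ has the fixed point property if every nonexpansive $T:A\to A$ has a fixed point; $A$ has the approximate fixed point property if $\inf\{d(x,Tx):x\in A\}=0$ for every nonexpansive $T:A\to A$. Lion-Man game in a nonempty convex subset $A$ of a uniquely geodesic space: take $D>0$ and starting points $L_0,M_0\in A$ of the lion and the man. At step $n+1$, $n\in\mathbb{N}=\{0,1,2,\dots\}$, the lion moves from $L_n$ to the point $L_{n+1}\in[L_n,M_n]$ with $d(L_n,L_{n+1})=\min\{D,d(L_n,M_n)\}$, and the man moves from $M_n$ to a point $M_{n+1}\in A$ with $d(M_n,M_{n+1})\le D$. The lion wins if $d(L_{n+1},M_n)\to 0$ as $n\to\infty$; otherwise the man wins. The lion always wins means that the lion wins for every $D>0$, all starting points $L_0,M_0\in A$, and every admissible sequence of moves $(M_n)$ of the man. *)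

(* Defs.v *)
From mathcomp Require Export all_boot all_order all_algebra.
From mathcomp Require Export all_classical all_reals all_analysis.
Export Order.TTheory GRing.Theory Num.Theory.
Export numFieldNormedType.Exports.

Set Implicit Arguments.
Unset Strict Implicit.
Unset Printing Implicit Defensive.

Local Open Scope classical_set_scope.
Local Open Scope ring_scope.

Definition complete_metric (R : realType) (X : metricType R) : Prop :=
  forall u : nat -> X, cauchy (u @ \oo) -> exists x : X, u @ \oo --> x.

Section GeodesicSpaces.
Context {R : realType} {X : metricType R}.
Implicit Types (x y p q : X) (A S : set X) (g : R -> X).

(* Maps defined on a subset of R are represented by total functions whose
   values outside that subset are irrelevant. *)
Definition geodesic (a b : R) x y g : Prop :=
  [/\ a <= b, g a = x, g b = y &
      forall s t, a <= s <= b -> a <= t <= b -> mdist (g s) (g t) = `|s - t|].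

Definition geodesic_segment x y S : Prop :=
  exists a b g, geodesic a b x y g /\ S = g @` `[a, b].

(* The union of all geodesic segments joining x and y; in a uniquely geodesic
   space it is the segment [x, y]. *)
Definition segment x y : set X :=
  [set p | exists2 S, geodesic_segment x y S & S p].

Definition geodesically_convex A : Prop :=
  forall x y S, A x -> A y -> geodesic_segment x y S -> S `<=` A.

(* The side S i joins v i to v (i + 1), indices being taken modulo 3. *)
Definition geodesic_triangle (v : 'I_3 -> X) (S : 'I_3 -> set X) : Prop :=
  forall i, geodesic_segment (v i) (v (ordS i)) (S i).

Definition geodesic_ray g : Prop :=
  forall s t, 0 <= s -> 0 <= t -> mdist (g s) (g t) = `|s - t|.

Definition directional_curve g : Prop :=
  exists2 b : R, 0 <= b & forall s t, 0 <= s -> 0 <= t ->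
    `|s - t| - b <= mdist (g s) (g t) <= `|s - t|.

Definition geodesically_bounded A : Prop :=
  ~ exists2 g, geodesic_ray g & g @` `[0, +oo[ `<=` A.

Definition directionally_bounded A : Prop :=
  ~ exists2 g, directional_curve g & g @` `[0, +oo[ `<=` A.

(* T restricts to a nonexpansive self-map of A; its values outside A are
   irrelevant. *)
Definition nonexpansive_on A (T : X -> X) : Prop :=
  (forall x, A x -> A (T x)) /\
  (forall x y, A x -> A y -> mdist (T x) (T y) <= mdist x y).

Definition fixed_point_property A : Prop :=
  forall T : X -> X, nonexpansive_on A T -> exists2 x, A x & T x = x.

Definition approximate_fixed_point_property A : Prop :=
  forall T : X -> X, nonexpansive_on A T ->
    inf [set mdist x (T x) | x in A] = 0.

Definition lion_man_play A (D : R) (L M : nat -> X) : Prop :=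
  [/\ A (L 0%N), A (M 0%N) &
      forall n,
        [/\ segment (L n) (M n) (L n.+1),
            mdist (L n) (L n.+1) = Num.min D (mdist (L n) (M n)),
            A (M n.+1) &
            mdist (M n) (M n.+1) <= D]].

Definition lion_wins (L M : nat -> X) : Prop :=
  mdist (L n.+1) (M n) @[n --> \oo] --> (0 : R).

Definition lion_always_wins A : Prop :=
  forall (D : R) (L M : nat -> X),
    0 < D -> lion_man_play A D L M -> lion_wins L M.

End GeodesicSpaces.

Section EuclideanPlane.
Context {R : realType}.

(* The norm the library puts on row vectors is the sup norm, hence this
   explicit Euclidean distance. *)
Definition edist (p q : 'rV[R]_2) : R :=
  Num.sqrt (\sum_i (p ord0 i - q ord0 i) ^+ 2).

Definition esegment (p q : 'rV[R]_2) : set 'rV[R]_2 :=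
  [set (1 - t) *: p + t *: q | t in `[0, 1]].

End EuclideanPlane.

Section CurvatureConditions.
Context {R : realType}.
Variable X : metricType R.

Definition geodesic_space : Prop :=
  forall x y : X, exists S, geodesic_segment x y S.

Definition comparison_triangle (v : 'I_3 -> X) (w : 'I_3 -> 'rV[R]_2) : Prop :=
  forall i j, edist (w i) (w j) = mdist (v i) (v j).

(* p' is the comparison point, on the side of w number i, of a point p on the
   side of v number i. *)
Definition comparison_point (v : 'I_3 -> X) (w : 'I_3 -> 'rV[R]_2) (i : 'I_3)
    (p : X) (p' : 'rV[R]_2) : Prop :=
  esegment (w i) (w (ordS i)) p' /\ edist (w i) p' = mdist (v i) p.

Definition CAT0_space : Prop :=
  geodesic_space /\
  forall (v : 'I_3 -> X) (S : 'I_3 -> set X) (w : 'I_3 -> 'rV[R]_2),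
    geodesic_triangle v S -> comparison_triangle v w ->
    forall (i j : 'I_3) (p q : X) (p' q' : 'rV[R]_2),
      S i p -> S j q ->
      comparison_point v w i p p' -> comparison_point v w j q q' ->
      mdist p q <= edist p' q'.

(* Neighborhoods are closed, so that delta = 0 is meaningful (R-trees);
   geodesic segments being compact, "at distance at most delta from the union
   of the other two sides" is attained. *)
Definition hyperbolic_space (delta : R) : Prop :=
  geodesic_space /\
  forall (v : 'I_3 -> X) (S : 'I_3 -> set X), geodesic_triangle v S ->
    forall (i : 'I_3) (p : X), S i p ->
      exists2 q, (\bigcup_(j in [set j | j != i]) S j) q & mdist p q <= delta.

End CurvatureConditions.

(* Main.v *)
Require Import Defs.
From mathcomp Require Import zify ring lra.

Set Implicit Arguments.
Unset Strict Implicit.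
Unset Printing Implicit Defensive.

Local Open Scope classical_set_scope.
Local Open Scope ring_scope.

(** A geodesic ray in A defeats everything: it is a directional curve, moving a
    point of A to the point of the ray one unit past its (nonnegative part of
    the) Busemann function is nonexpansive and displaces every point by at
    least 1, and on the ray the man runs away from a lion that follows him.

    Conversely, the engine is this: if a sequence in A has Gromov products,
    based at a point o of A, tending to infinity, then A contains a ray. By the
    four-point condition the segments from o to the terms of the sequence
    fellow-travel for a long time, and convexity of the CAT(0) metric makes
    their points at a fixed distance from o a Cauchy sequence. Such a sequence
    arises from a directional curve; from a nonexpansive map T without fixed
    points, by the solutions x_s of x_s = (1 - s) p + s T x_s as s -> 1, for
    which d(x_s, x_t)^2 <= d(p, x_t)^2 - d(p, x_s)^2; and from a losing lion,
    whose path is asymptotically geodesic at every scale, hence by hyperbolicity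
    goes to infinity in a definite direction. *)

(** * Cauchy sequences in closed subsets *)

Section MetricSequences.
Context {R : realType} {X : metricType R}.
Local Notation d := (@mdist R X).

Definition mcauchy (u : nat -> X) : Prop := forall e : R, 0 < e ->
  exists N, forall n m, (N <= n)%N -> (N <= m)%N -> d (u n) (u m) < e.

Definition mlimit (u : nat -> X) (x : X) : Prop := forall e : R, 0 < e ->
  exists N, forall n, (N <= n)%N -> d (u n) x < e.

Lemma mcauchy_limit (A : set X) (u : nat -> X) :
  complete_metric X -> closed A -> (forall n, A (u n)) -> mcauchy u ->
  exists2 x, A x & mlimit u x.
Proof.
move=> Xc Acl Au uc.
have [x ux] : exists x : X, u @ \oo --> x.
  apply: Xc; apply: cauchy_exP => e e0.
  have [N HN] := uc e e0.
  by exists (u N); exists N => // n nN; rewrite /= ballEmdist /=; exact: HN.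
exists x.
  by apply: (@closed_cvg _ _ (nbhs \oo) _ u A Acl _ x ux); exact: nearW.
move=> e e0.
have /metricType_numDomainType.cvgrPdist_lt/(_ e e0) [N _ HN] := ux.
by exists N => n nN; rewrite metric_sym; exact: HN.
Qed.

End MetricSequences.

(** * Points dividing a geodesic in a given ratio *)

Section GeodesicPoints.
Context {R : realType} {X : metricType R}.
Local Notation d := (@mdist R X).
Implicit Types (x y z p q : X) (t : R).

(** Only distances are prescribed, so no segment has to be carried along; in a CAT(0) space they
    determine the point for [t] in [0, 1]. *)
Definition between x y t p : Prop :=
  d x p = t * d x y /\ d p y = (1 - t) * d x y.

Lemma geodesic_between x y S t : geodesic_segment x y S -> 0 <= t <= 1 ->
  exists2 p, S p & between x y t p.
Proof.
move=> [a [b [g [[ab ga gb gd] ->]]]] /andP[t0 t1].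
have dxy : d x y = b - a.
  rewrite -ga -gb gd ?lexx ?ab //; rewrite distrC ger0_norm //; lra.
have tab : 0 <= t * (b - a) <= b - a.
  by apply/andP; split; [rewrite mulr_ge0 ?subr_ge0|rewrite ler_piMl ?subr_ge0].
have hc : a <= a + t * (b - a) <= b by lra.
exists (g (a + t * (b - a))).
  by exists (a + t * (b - a)) => //=; rewrite in_itv /= hc.
split; rewrite dxy.
  by rewrite -ga gd ?lexx ?ab // distrC ger0_norm; lra.
by rewrite -gb gd ?lexx ?ab // distrC ger0_norm; lra.
Qed.

Lemma segment_add x y S p : geodesic_segment x y S -> S p ->
  d x p + d p y = d x y.
Proof.
move=> [a [b [g [[ab ga gb gd] ->]]]] [c /=]; rewrite in_itv /= => hc <-.
rewrite -ga -gb !gd ?lexx ?ab //.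
have -> : `|a - c| = c - a by rewrite distrC ger0_norm; lra.
have -> : `|c - b| = b - c by rewrite distrC ger0_norm; lra.
have -> : `|a - b| = b - a by rewrite distrC ger0_norm; lra.
by ring.
Qed.

End GeodesicPoints.

(** * Coordinates in the Euclidean comparison plane *)

Section Comparison.
Context {R : realType}.

Definition pt2 (a b : R) : 'rV[R]_2 := \row_(j < 2) (if j == ord0 then a else b).

Lemma edist_pt2 (a b a' b' : R) :
  edist (pt2 a b) (pt2 a' b') = Num.sqrt ((a - a') ^+ 2 + (b - b') ^+ 2).
Proof. by rewrite /edist !big_ord_recl big_ord0 !mxE /= addr0. Qed.

Lemma pt2_comb (t a b a' b' : R) :
  (1 - t) *: pt2 a b + t *: pt2 a' b' =
  pt2 ((1 - t) * a + t * a') ((1 - t) * b + t * b').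
Proof. by apply/rowP => j; rewrite !mxE; case: ifP. Qed.

End Comparison.

(** * CAT(0) spaces: the CN inequality and convexity of the metric *)

Section CAT0.
Context {R : realType} {X : metricType R}.
Local Notation d := (@mdist R X).
Implicit Types (x y z p q : X) (t : R).

Definition tri (T : Type) (x y z : T) : 'I_3 -> T :=
  fun i => match val i with 0%N => x | 1%N => y | _ => z end.

Lemma geodesic_triangle_tri x y z Sxy Syz Szx :
  geodesic_segment x y Sxy -> geodesic_segment y z Syz ->
  geodesic_segment z x Szx ->
  geodesic_triangle (tri x y z) (tri Sxy Syz Szx).
Proof. by move=> h1 h2 h3 [[|[|[|//]]] i]. Qed.

Lemma sqrtr_eq (u v : R) : 0 <= v -> u = v ^+ 2 -> Num.sqrt u = v.
Proof. by move=> v0 ->; rewrite sqrtr_sqr ger0_norm. Qed.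

Hypothesis X_CAT0 : CAT0_space X.

Lemma between_exists x y t : 0 <= t <= 1 -> exists p, between x y t p.
Proof.
move=> t01; have [S hS] := X_CAT0.1 x y.
by have [p _ hp] := geodesic_between hS t01; exists p.
Qed.

(* The comparison triangle has x' = (0, 0), y' = (d x y, 0) and z' = (u, v),
   u being given by the law of cosines. *)
Lemma CN_on_segment x y z S t p : geodesic_segment x y S -> S p ->
  0 <= t <= 1 -> between x y t p ->
  d z p ^+ 2 <= (1 - t) * d z x ^+ 2 + t * d z y ^+ 2
                - t * (1 - t) * d x y ^+ 2.
Proof.
move=> hS Sp /andP[t0 t1] [xp py].
have [c0|cN0] := eqVneq (d x y) 0.
  have exy := mdist_positivity _ _ c0; subst y.
  have exp : x = p by apply: mdist_positivity; rewrite xp c0 mulr0.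
  by subst p; rewrite c0; nra.
have [Syz hyz] := X_CAT0.1 y z.
have [Szx hzx] := X_CAT0.1 z x.
set c := d x y in cN0 xp py *; set b := d z x; set a := d z y.
have c0 : 0 < c by rewrite lt_neqAle eq_sym cN0 mdist_ge0.
have b0 : 0 <= b by exact: mdist_ge0.
have a0 : 0 <= a by exact: mdist_ge0.
have tr1 : c <= b + a by rewrite /c /b (metric_sym z x); exact: metric_triangle.
have tr2 : b <= a + c.
  by rewrite /c (metric_sym x y); exact: metric_triangle.
have tr3 : a <= b + c by exact: metric_triangle.
set u := (b ^+ 2 + c ^+ 2 - a ^+ 2) / (2 * c).
have uc : 2 * u * c = b ^+ 2 + c ^+ 2 - a ^+ 2 by rewrite /u; field.
(* The triangle inequalities make [a ^+ 2 - (b - c) ^+ 2] and [(b + c) ^+ 2 - a ^+ 2] nonnegative;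
   these are [2 * c * (b - u)] and [2 * c * (b + u)]. Hence [z'] has a real height [v]. *)
have ub : u ^+ 2 <= b ^+ 2.
  have h1 : u <= b.
    rewrite -(ler_pM2r (x := 2 * c)) ?mulr_gt0 //; nra.
  have h2 : - b <= u.
    rewrite -(ler_pM2r (x := 2 * c)) ?mulr_gt0 //; nra.
  by nra.
set v := Num.sqrt (b ^+ 2 - u ^+ 2).
have vv : v ^+ 2 = b ^+ 2 - u ^+ 2 by rewrite sqr_sqrtr // subr_ge0.
pose w := tri (pt2 0 0) (pt2 c 0) (pt2 u v).
have hw : comparison_triangle (tri x y z) w.
  by move=> [[|[|[|//]]] i] [[|[|[|//]]] j]; rewrite /w /tri /= edist_pt2
    ?mdistxx; apply: sqrtr_eq => //; rewrite ?mdist_ge0 //;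
    rewrite ?(metric_sym y x) ?(metric_sym y z) ?(metric_sym x z)
      -?/a -?/b -?/c; nra.
have tri_g := geodesic_triangle_tri hS hyz hzx.
have zS : Szx z.
  have [z' Sz' [hz _]] := @geodesic_between _ _ _ _ _ 0 hzx (introT andP (conj (lexx _) ler01)).
  by have -> : z = z' by apply: mdist_positivity; rewrite hz mul0r.
pose i0 : 'I_3 := Ordinal (isT : (0 < 3)%N).
pose i2 : 'I_3 := Ordinal (isT : (2 < 3)%N).
have cp : comparison_point (tri x y z) w i0 p (pt2 (t * c) 0).
  split.
    exists t; first by rewrite /= in_itv /= t0.
    by rewrite /w /tri /= pt2_comb !mulr0 add0r addr0.
  rewrite /w /tri /= edist_pt2 xp; apply: sqrtr_eq; first by rewrite mulr_ge0 // ltW.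
  by ring.
have cz : comparison_point (tri x y z) w i2 z (pt2 u v).
  split.
    exists 0; first by rewrite /= in_itv /= lexx ler01.
    by rewrite /w /tri /= subr0 scale1r scale0r addr0.
  rewrite /w /tri /= edist_pt2 mdistxx; apply: sqrtr_eq => //.
  by ring.
have := X_CAT0.2 _ _ _ tri_g hw i0 i2 p z _ _ Sp zS cp cz.
rewrite edist_pt2 (metric_sym p z) => h.
have s0 : 0 <= (t * c - u) ^+ 2 + (0 - v) ^+ 2 by rewrite addr_ge0 ?sqr_ge0.
have : d z p ^+ 2 <= (t * c - u) ^+ 2 + (0 - v) ^+ 2.
  by rewrite -(sqr_sqrtr s0) ler_sqr ?nnegrE ?sqrtr_ge0 ?mdist_ge0.
by nra.
Qed.

(** With a competitor itself as the vertex [z], the right side of the CN inequality vanishes, so it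
    equals the point found on a chosen segment. *)
Lemma between_unique x y t p q : 0 <= t <= 1 ->
  between x y t p -> between x y t q -> p = q.
Proof.
move=> t01 hp hq.
have [S hS] := X_CAT0.1 x y.
have [r Sr hr] := geodesic_between hS t01.
have key s : between x y t s -> s = r.
  move=> [h1 h2]; apply: mdist_positivity.
  have := CN_on_segment s hS Sr t01 hr.
  rewrite (metric_sym s x) h1 h2 => h.
  have h' : d s r ^+ 2 <= 0 by lra.
  by apply/eqP; rewrite -sqrf_eq0 eq_le h' sqr_ge0.
by rewrite (key p) // (key q).
Qed.

Lemma CN_inequality x y z t p : 0 <= t <= 1 -> between x y t p ->
  d z p ^+ 2 <= (1 - t) * d z x ^+ 2 + t * d z y ^+ 2
                - t * (1 - t) * d x y ^+ 2.
Proof.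
move=> t01 hp.
have [S hS] := X_CAT0.1 x y.
have [r Sr hr] := geodesic_between hS t01.
by rewrite (between_unique t01 hp hr); exact: (CN_on_segment z hS Sr t01 hr).
Qed.

Lemma between_convex A x y t p : geodesically_convex A -> A x -> A y ->
  0 <= t <= 1 -> between x y t p -> A p.
Proof.
move=> Ac Ax Ay t01 hp.
have [S hS] := X_CAT0.1 x y.
have [r Sr hr] := geodesic_between hS t01.
by rewrite (between_unique t01 hp hr); exact: (Ac _ _ _ Ax Ay hS).
Qed.

(** As [d z x] and [d z y] differ by at most [d x y], the right side of the CN inequality is at most
    the square of the claimed bound. *)
Lemma dist_convex x y z t p : 0 <= t <= 1 -> between x y t p ->
  d z p <= (1 - t) * d z x + t * d z y.
Proof.
move=> /andP[t0 t1] hp.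
have h := CN_inequality z (t := t) (introT andP (conj t0 t1)) hp.
have h1 : d z x <= d z y + d x y.
  by rewrite (metric_sym x y); exact: metric_triangle.
have h2 : d z y <= d z x + d x y by exact: metric_triangle.
have zx := mdist_ge0 z x; have zy := mdist_ge0 z y.
rewrite -ler_sqr ?nnegrE ?mdist_ge0 //; last by rewrite addr_ge0 // mulr_ge0 ?subr_ge0.
apply: (le_trans h).
have h3 : (d z x - d z y) ^+ 2 <= d x y ^+ 2 by nra.
have h4 : 0 <= t * (1 - t) by rewrite mulr_ge0 ?subr_ge0.
have h5 := ler_wpM2l h4 h3.
by nra.
Qed.

(** The CN inequality is used on [o, u] seen from [vt], then on [o, v] seen from [u]. For [s = t]
    the result says that shrinking towards [o] by the factor [t] shrinks distances by at least that
    factor. *)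
Lemma CN_two_points o u v s t us vt : 0 <= s <= 1 -> 0 <= t <= 1 ->
  between o u s us -> between o v t vt ->
  d us vt ^+ 2 <= s * (s - t) * d o u ^+ 2 + t * (t - s) * d o v ^+ 2
                  + s * t * d u v ^+ 2.
Proof.
move=> s01 t01 hu hv.
have h1 := CN_inequality vt s01 hu.
have h2 := CN_inequality u t01 hv.
have h3 : d vt o = t * d o v by rewrite metric_sym; case: hv.
move: h1 h2; rewrite (metric_sym us vt) (metric_sym u o) (metric_sym u vt) h3.
case/andP: s01 => s0 _ h1 h2.
have h4 := ler_wpM2l s0 h2.
by nra.
Qed.

End CAT0.

(** * Gromov products and the four-point condition *)

Section Hyperbolicity.
Context {R : realType} {X : metricType R}.
Local Notation d := (@mdist R X).
Implicit Types (o x y z p q : X).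

Definition gromov_product o x y : R := (d o x + d o y - d x y) / 2.

Lemma gromov_product_sym o x y : gromov_product o x y = gromov_product o y x.
Proof. by rewrite /gromov_product (metric_sym x y); lra. Qed.

Lemma gromov_product_ge0 o x y : 0 <= gromov_product o x y.
Proof.
have h1 := metric_triangle x o y; have h2 := metric_sym x o.
by rewrite /gromov_product; lra.
Qed.

Lemma gromov_product_base o x y :
  gromov_product o x y = d o x - gromov_product x o y.
Proof. by rewrite /gromov_product (metric_sym x o); lra. Qed.

Lemma geodesic_segment_at x y S (c : R) : geodesic_segment x y S ->
  0 <= c <= d x y -> exists2 p, S p & d x p = c /\ d p y = d x y - c.
Proof.
move=> hS c01.
have [d0|dN0] := eqVneq (d x y) 0.
  have [p Sp [h1 h2]] := geodesic_between (t := 0) hS (introT andP (conj (lexx _) ler01)).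
  by exists p => //; lra.
have dgt : 0 < d x y by rewrite lt_neqAle eq_sym dN0 mdist_ge0.
have t01 : 0 <= c / d x y <= 1.
  by case/andP: c01 => c0 c1; rewrite divr_ge0 ?mdist_ge0 //= ler_pdivrMr // mul1r.
have [p Sp [h1 h2]] := geodesic_between hS t01.
exists p => //; rewrite h1 h2; split; field; exact: dN0.
Qed.

Variable delta : R.
Hypothesis X_hyp : hyperbolic_space X delta.

Lemma thin_triangle x y z Sxy Syz Szx p :
  geodesic_segment x y Sxy -> geodesic_segment y z Syz ->
  geodesic_segment z x Szx -> Sxy p ->
  exists2 q, Syz q \/ Szx q & d p q <= delta.
Proof.
move=> h1 h2 h3 Sp.
pose i0 : 'I_3 := Ordinal (isT : (0 < 3)%N).
have [q [j /= ji Sq] pq] :=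
  X_hyp.2 _ _ (geodesic_triangle_tri h1 h2 h3) i0 p Sp.
exists q => //.
case: j ji Sq => [[|[|[|//]]] hj] ji Sq.
- by case/eqP: ji; exact: val_inj.
- by left.
- by right.
Qed.

(* The bound comes from the internal point [p] of the side [x, z] of the
   triangle [o, x, z], which lies within [gromov_product o x z + 2 * delta]
   of [o]. *)
Lemma four_point o x y z :
  gromov_product o x y <= gromov_product o x z + 3 * delta \/
  gromov_product o y z <= gromov_product o x z + 3 * delta.
Proof.
have [Sxz hxz] := X_hyp.1 x z.
have [Szo hzo] := X_hyp.1 z o.
have [Sox hox] := X_hyp.1 o x.
have [Szy hzy] := X_hyp.1 z y.
have [Syx hyx] := X_hyp.1 y x.
have xz := metric_sym x z; have xo := metric_sym x o; have zo := metric_sym z o.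
have xy := metric_sym x y; have yz := metric_sym y z.
have [p Sp [xp pz]] : exists2 p, Sxz p &
    d x p = gromov_product x o z /\ d p z = d x z - gromov_product x o z.
  apply: geodesic_segment_at => //.
  rewrite gromov_product_ge0 gromov_product_sym gromov_product_base.
  by rewrite lerBlDr lerDl gromov_product_ge0.
have op : d o p <= gromov_product o x z + 2 * delta.
  move: xp pz; rewrite /gromov_product => xp pz.
  have [q [Sq|Sq] pq] := thin_triangle hxz hzo hox Sp.
    have h1 := segment_add hzo Sq.
    have h2 := metric_triangle o q p; have h3 := metric_triangle z q p.
    have h4 := metric_sym p q; have h5 := metric_sym o q.
    by have h6 := metric_sym p z; lra.
  have h1 := segment_add hox Sq.
  have h2 := metric_triangle o q p; have h3 := metric_triangle x q p.
  have h4 := metric_sym p q; have h5 := metric_sym x q.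
  by lra.
have [q Sq pq] := thin_triangle hxz hzy hyx Sp.
have oq : d o q <= gromov_product o x z + 3 * delta.
  by have := metric_triangle o p q; lra.
have oq' := metric_sym o q.
case: Sq => Sq; [right|left]; apply: le_trans oq.
- have h1 := segment_add hzy Sq.
  have h2 := metric_triangle o q y; have h3 := metric_triangle o q z.
  by have h4 := metric_sym z q; rewrite /gromov_product; lra.
- have h1 := segment_add hyx Sq.
  have h2 := metric_triangle o q y; have h3 := metric_triangle o q x.
  by have h4 := metric_sym y q; rewrite /gromov_product; lra.
Qed.

End Hyperbolicity.

(** * A ray from Gromov products tending to infinity *)

Section RayFromGromovProducts.
Context {R : realType} {X : metricType R}.
Local Notation d := (@mdist R X).
Variables (delta : R) (A : set X).
Hypotheses (X_complete : complete_metric X) (X_CAT0 : CAT0_space X).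
Hypotheses (delta_ge0 : 0 <= delta) (X_hyp : hyperbolic_space X delta).
Hypotheses (A_closed : closed A) (A_convex : geodesically_convex A).


(* The junk value [o], taken for r outside [0, d o x], lies in A as well. *)
Definition toward (o x : X) (r : R) : X :=
  xget o [set p | 0 <= r <= d o x /\ between o x (r / d o x) p].

Lemma div_dist01 (o x : X) (r : R) : 0 <= r <= d o x -> 0 <= r / d o x <= 1.
Proof.
move=> /andP[r0 r1].
have [d0|dN0] := eqVneq (d o x) 0; first by rewrite d0 invr0 mulr0 lexx ler01.
have dgt : 0 < d o x by rewrite lt_neqAle eq_sym dN0 mdist_ge0.
by rewrite divr_ge0 ?mdist_ge0 //= ler_pdivrMr // mul1r.
Qed.

Lemma toward_in (o x : X) (r : R) : A o -> A x -> A (toward o x r).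
Proof.
move=> Ao Ax; rewrite /toward; case: xgetP => [p _ [h hb]|//].
exact: (between_convex X_CAT0 A_convex Ao Ax (div_dist01 h) hb).
Qed.

Lemma toward_between (o x : X) (r : R) : 0 <= r <= d o x ->
  between o x (r / d o x) (toward o x r).
Proof.
move=> h; have [p hp] := between_exists X_CAT0 o x (div_dist01 h).
rewrite /toward; case: xgetP => [q _ []//|/(_ p)]; by case.
Qed.

Lemma toward_dist (o x : X) (r : R) : 0 <= r <= d o x ->
  d o (toward o x r) = r /\ d (toward o x r) x = d o x - r.
Proof.
move=> h; have [-> ->] := toward_between h.
have [d0|dN0] := eqVneq (d o x) 0; last by split; field; exact: dN0.
by move: h; rewrite d0 invr0 !mulr0; lra.
Qed.

(** [CN_two_points] with both endpoints equal to [x] gives the upper bound, the triangle inequality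
    from [o] the lower one. *)
Lemma toward_isometry (o x : X) (r s : R) :
  0 <= r <= d o x -> 0 <= s <= d o x ->
  d (toward o x r) (toward o x s) = `|r - s|.
Proof.
move=> hr hs.
have [r1 r2] := toward_dist hr; have [s1 s2] := toward_dist hs.
have h := CN_two_points X_CAT0 (div_dist01 hr) (div_dist01 hs)
  (toward_between hr) (toward_between hs).
have h1 := metric_triangle o (toward o x r) (toward o x s).
have h2 := metric_triangle o (toward o x s) (toward o x r).
have h3 := metric_sym (toward o x r) (toward o x s).
apply/eqP; rewrite eq_le; apply/andP; split; last by rewrite ler_norml; lra.
rewrite -ler_sqr ?nnegrE ?mdist_ge0 // real_normK ?num_real //.
apply: (le_trans h); rewrite mdistxx.
have [d0|dN0] := eqVneq (d o x) 0.
  by have -> : s = r; [lra | rewrite d0 subrr; lra].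
rewrite le_eqVlt; apply/orP; left; apply/eqP; field; exact: dN0.
Qed.

Lemma gromov_product_le (o x y : X) : gromov_product o x y <= d o x.
Proof. by rewrite gromov_product_base lerBlDr lerDl gromov_product_ge0. Qed.

(** Consecutive products along [u], [x], [y], [v] are at least [K], so two uses of the four-point
    condition give at least [K - 6 * delta] for [u] and [v]; that product is [K - d u v / 2]. *)
Lemma geodesics_fellow_travel (o x y u v : X) (K : R) :
  d o u = K -> d u x = d o x - K -> d o v = K -> d v y = d o y - K ->
  K <= gromov_product o x y -> d u v <= 12 * delta.
Proof.
move=> x1 x2 y1 y2 Kxy.
have ux : gromov_product o u x = K by rewrite /gromov_product x1 x2; lra.
have yv : gromov_product o y v = K.
  by rewrite /gromov_product y1 (metric_sym y) y2; lra.
have uvE : gromov_product o u v = K - d u v / 2.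
  by rewrite /gromov_product x1 y1; lra.
have := four_point X_hyp o u x v; have := four_point X_hyp o x y v.
have dge0 := delta_ge0.
by rewrite ux yv uvE => -[h1|h1] [h2|h2]; lra.
Qed.

(** The gap of at most [12 * delta] at distance [K] from [o] is scaled down by [r / K] by convexity.
    For fixed [r] the bound vanishes as [K] grows, which turns fellow-travelling into the Cauchy
    property. *)
Lemma toward_close (o x y : X) (r K : R) :
  0 <= r <= K -> 0 < K -> K <= gromov_product o x y ->
  d (toward o x r) (toward o y r) <= r / K * (12 * delta).
Proof.
move=> rK K0 Kxy.
have Kx : 0 <= K <= d o x.
  by rewrite (ltW K0) (le_trans Kxy) ?gromov_product_le.
have Ky : 0 <= K <= d o y.
  rewrite (ltW K0) (le_trans Kxy) // gromov_product_sym.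
  exact: gromov_product_le.
have rx : 0 <= r <= d o x by lra.
have ry : 0 <= r <= d o y by lra.
have [x1 x2] := toward_dist Kx; have [y1 y2] := toward_dist Ky.
have [x1' _] := toward_dist rx; have [y1' _] := toward_dist ry.
have xx := toward_isometry rx Kx; have yy := toward_isometry ry Ky.
have nrK : `|r - K| = K - r by rewrite distrC ger0_norm; lra.
set u := toward o x K in x1 x2 xx *; set v := toward o y K in y1 y2 yy *.
have uv : d u v <= 12 * delta.
  exact: (geodesics_fellow_travel x1 x2 y1 y2).
have t01 : 0 <= r / K <= 1.
  by case/andP: rK => r0 rK; rewrite divr_ge0 ?(ltW K0) //= ler_pdivrMr // mul1r.
have KN0 : K != 0 by rewrite gt_eqF.
have bx : between o u (r / K) (toward o x r).
  by split; rewrite ?x1' ?xx x1 ?nrK; field.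
have byy : between o v (r / K) (toward o y r).
  by split; rewrite ?y1' ?yy y1 ?nrK; field.
have h := CN_two_points X_CAT0 t01 t01 bx byy.
have t0 : 0 <= r / K by case/andP: t01.
apply: (@le_trans _ _ (r / K * d u v)); last exact: ler_wpM2l.
rewrite -ler_sqr ?nnegrE ?mdist_ge0 //; last exact: mulr_ge0 t0 (mdist_ge0 _ _).
by apply: (le_trans h); rewrite subrr; nra.
Qed.

Lemma ray_from_gromov_products (o : X) (x : nat -> X) :
  A o -> (forall n, A (x n)) ->
  (forall K : R, exists N, forall n m, (N <= n)%N -> (N <= m)%N ->
     K <= gromov_product o (x n) (x m)) ->
  ~ geodesically_bounded A.
Proof.
move=> Ao Ax xoo; apply.
have far r : exists N, forall n, (N <= n)%N -> r <= d o (x n).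
  have [N HN] := xoo r; exists N => n nN.
  exact: le_trans (HN n n nN nN) (gromov_product_le _ _ _).
have /choice[g hg] : forall r : R, exists y, 0 <= r ->
    A y /\ mlimit (fun n => toward o (x n) r) y.
  move=> r; have [r0|] := leP 0 r; last by exists o => ?; lra.
  have [|y Ay uy] := mcauchy_limit (u := fun n => toward o (x n) r)
    X_complete A_closed (fun n => toward_in r Ao (Ax n)); last by exists y.
  move=> e e0.
  (* The part [r + 1] makes [K] positive and at least [r]; the last term brings
     [r / K * (12 * delta)] below [e]. *)
  pose K := r + 1 + 12 * delta * r / e.
  have K1 : 0 <= 12 * delta * r / e.
    by rewrite divr_ge0 ?(ltW e0) // mulr_ge0 // mulr_ge0.
  have K0 : 0 < K by rewrite /K; lra.
  have [N HN] := xoo K.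
  exists N => n m nN mN.
  have rK : 0 <= r <= K by rewrite /K; lra.
  apply: le_lt_trans (toward_close rK K0 (HN n m nN mN)) _.
  rewrite mulrAC ltr_pdivrMr // /K.
  have -> : e * (r + 1 + 12 * delta * r / e) = e * r + e + 12 * delta * r.
    by field; rewrite gt_eqF.
  by have := mulr_ge0 (ltW e0) r0; lra.
exists g; last by move=> _ [r /= + <-]; rewrite in_itv /= andbT => /hg[].
move=> s t s0 t0.
have [_ gs] := hg s s0; have [_ gt] := hg t t0.
have [Ns HNs] := far s; have [Nt HNt] := far t.
(* For one large [n] both approximating points lie on the same segment from [o], where distances are
   exact. *)
have approx e : 0 < e -> `|s - t| - e <= d (g s) (g t) <= `|s - t| + e.
  move=> e0; have e20 : 0 < e / 2 by lra.
  have [N1 H1] := gs _ e20; have [N2 H2] := gt _ e20.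
  pose n := (N1 + N2 + Ns + Nt)%N.
  have h1 : d (toward o (x n) s) (g s) < e / 2 by apply: H1; rewrite /n; lia.
  have h2 : d (toward o (x n) t) (g t) < e / 2 by apply: H2; rewrite /n; lia.
  have h3 : s <= d o (x n) by apply: HNs; rewrite /n; lia.
  have h4 : t <= d o (x n) by apply: HNt; rewrite /n; lia.
  rewrite -(toward_isometry (x := x n) (introT andP (conj s0 h3)) (introT andP (conj t0 h4))).
  set u := toward o (x n) s in h1 *; set v := toward o (x n) t in h2 *.
  have := metric_triangle (g s) u (g t); have := metric_triangle u v (g t).
  have := metric_triangle u (g s) v; have := metric_triangle (g s) (g t) v.
  have := metric_sym u (g s); have := metric_sym v (g t).
  by move=> *; lra.
apply/eqP; rewrite eq_le; apply/andP; split; apply/ler_addgt0Pr => e e0;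
  by have := approx e e0; lra.
Qed.

End RayFromGromovProducts.

(** * What a ray in the set destroys *)

Section RayInSet.
Context {R : realType} {X : metricType R}.
Local Notation d := (@mdist R X).
Variables (A : set X) (g : R -> X).
Hypotheses (g_ray : geodesic_ray g) (g_in : g @` `[0, +oo[ `<=` A).

Lemma ray_in (r : R) : 0 <= r -> A (g r).
Proof. by move=> r0; apply: g_in; exists r; rewrite //= in_itv /= r0. Qed.

Lemma ray_not_directionally_bounded : ~ directionally_bounded A.
Proof.
apply; exists g => //; exists 0 => // s t s0 t0.
by rewrite g_ray // subr0 lexx.
Qed.

(** The sign is opposite to the usual one. The values are nondecreasing in [t], so the supremum is
    their limit at infinity. *)
Definition busemann (x : X) : R := sup [set t - d x (g t) | t in `[0, +oo[].

Lemma busemann_has_sup (x : X) : has_sup [set t - d x (g t) | t in `[0, +oo[].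
Proof.
split; first by exists (0 - d x (g 0)), 0; rewrite //= in_itv /= lexx.
exists (d x (g 0)) => _ [t /= + <-]; rewrite in_itv /= andbT => t0.
have := metric_triangle (g 0) x (g t); rewrite g_ray ?lexx //.
by rewrite (metric_sym (g 0) x) sub0r normrN ger0_norm //; lra.
Qed.

Lemma busemann_ge (x : X) (t : R) : 0 <= t -> t - d x (g t) <= busemann x.
Proof.
move=> t0; apply: (ub_le_sup (busemann_has_sup x).2).
by exists t; rewrite //= in_itv /= t0.
Qed.

Lemma busemann_lipschitz (x y : X) : busemann x <= busemann y + d x y.
Proof.
apply: ge_sup; first exact: (busemann_has_sup x).1.
move=> _ [t /= + <-]; rewrite in_itv /= andbT => t0.
have := busemann_ge y t0; have := metric_triangle y x (g t).
by rewrite (metric_sym y x); lra.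
Qed.

Lemma busemann_ray (r : R) : 0 <= r -> busemann (g r) = r.
Proof.
move=> r0; apply/eqP; rewrite eq_le; apply/andP; split; last first.
  by have := busemann_ge (g r) r0; rewrite mdistxx subr0.
apply: ge_sup; first exact: (busemann_has_sup _).1.
move=> _ [t /= + <-]; rewrite in_itv /= andbT => t0.
rewrite g_ray //; have := ler_norm (t - r); rewrite distrC; lra.
Qed.

(** The maximum keeps the parameter in the domain of the ray without spoiling the Lipschitz constant
    1. *)
Definition ray_shift (x : X) : X := g (Num.max 0 (busemann x) + 1).

Lemma ray_shift_ge0 (x : X) : 0 <= Num.max 0 (busemann x) + 1.
Proof. by rewrite addr_ge0 // le_max lexx. Qed.

Lemma ray_shift_nonexpansive : nonexpansive_on A ray_shift.
Proof.
split=> [x _|x y _ _]; first exact: ray_in (ray_shift_ge0 x).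
rewrite /ray_shift g_ray ?ray_shift_ge0 //.
have h1 := busemann_lipschitz x y; have h2 := busemann_lipschitz y x.
rewrite (metric_sym y x) in h2; have h3 := mdist_ge0 x y.
rewrite ler_norml; apply/andP.
by case: (leP 0 (busemann x)); case: (leP 0 (busemann y)) => *; split; lra.
Qed.

(** The shift raises [busemann], which is 1-Lipschitz, by at least 1. *)
Lemma ray_shift_displacement (x : X) : 1 <= d x (ray_shift x).
Proof.
have := busemann_lipschitz (ray_shift x) x.
rewrite /ray_shift busemann_ray ?ray_shift_ge0 // metric_sym.
have : busemann x <= Num.max 0 (busemann x) by rewrite le_max lexx orbT.
by lra.
Qed.

Lemma ray_not_approximate_fixed_point :
  A !=set0 -> ~ approximate_fixed_point_property A.
Proof.
move=> [x0 Ax0] /(_ _ ray_shift_nonexpansive) h.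
have : 1 <= inf [set d x (ray_shift x) | x in A].
  apply: lb_le_inf; first by exists (d x0 (ray_shift x0)), x0.
  by move=> _ [x _ <-]; exact: ray_shift_displacement.
by rewrite h; lra.
Qed.

Lemma ray_not_fixed_point : ~ fixed_point_property A.
Proof.
move=> /(_ _ ray_shift_nonexpansive)[x Ax fx].
by have := ray_shift_displacement x; rewrite fx mdistxx; lra.
Qed.

Lemma ray_not_lion_always_wins : ~ lion_always_wins A.
Proof.
move=> lion.
have n0 n : 0 <= n%:R :> R by exact: ler0n.
have dist_g (a b : R) : 0 <= a -> 0 <= b -> a <= b -> d (g a) (g b) = b - a.
  by move=> a0 b0 ab; rewrite g_ray // distrC ger0_norm // subr_ge0.
(* The man starts two units ahead and both advance by 1, so the lion is always 1 short after his
   move. *)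
have play : lion_man_play A 1 (fun n => g n%:R) (fun n => g (n%:R + 2)).
  split; [exact: ray_in|by apply: ray_in; rewrite addr_ge0|].
  move=> n; have n0' := n0 n; have nS : n.+1%:R = n%:R + 1 :> R by rewrite natr1.
  rewrite nS.
  split.
  - exists (g @` `[n%:R, n%:R + 2]).
      exists n%:R, (n%:R + 2), g; split=> //; split=> //; first lra.
      by move=> s t /andP[s0 _] /andP[t0 _]; apply: g_ray; lra.
    by exists (n%:R + 1); rewrite ?nS //= in_itv /=; lra.
  - rewrite !dist_g; [|lra..].
    by rewrite min_l; lra.
  - by apply: ray_in; lra.
  - by rewrite dist_g; lra.
have /cvgrPdist_lt/(_ 1 ltr01)[N _ /(_ N (leqnn N))] := lion _ _ _ ltr01 play.
have n0' := n0 N; have nS : N.+1%:R = N%:R + 1 :> R by rewrite natr1.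
rewrite /= nS dist_g; [|lra..].
by rewrite sub0r normrN ger0_norm; lra.
Qed.

End RayInSet.

(** * Archimedean and geometric estimates *)

Section Archimedean.
Context {R : realType}.

Lemma nat_above (K : R) : exists N : nat, K < N%:R.
Proof.
exists (Num.bound `|K|).
exact: le_lt_trans (ler_norm K) (archi_boundP (normr_ge0 K)).
Qed.

Lemma geometric_small (s c e : R) : 0 <= s < 1 -> 0 < e ->
  exists N, forall n, (N <= n)%N -> s ^+ n * c < e.
Proof.
move=> /andP[s0 s1] e0.
have c0 : 0 < `|c| + 1 by rewrite ltr_pwDr.
have s1' : `|s| < 1 by rewrite ger0_norm.
have /cvgrPdist_lt/(_ (e / (`|c| + 1)))[] := cvg_expr s1'.
  by rewrite divr_gt0.
move=> N _ HN; exists N => n nN.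
have := HN n nN; rewrite /= sub0r normrN ger0_norm ?exprn_ge0 //.
rewrite ltr_pdivlMr // => /(le_lt_trans _); apply.
rewrite ler_wpM2l ?exprn_ge0 //.
by rewrite (le_trans (ler_norm _)) // lerDl.
Qed.

End Archimedean.

(** * The contraction principle on a closed set *)

Section Contractions.
Context {R : realType} {X : metricType R}.
Local Notation d := (@mdist R X).

Lemma contraction_fixed_point (A : set X) (F : X -> X) (s : R) :
  complete_metric X -> closed A -> A !=set0 -> 0 <= s < 1 ->
  (forall x, A x -> A (F x)) ->
  (forall x y, A x -> A y -> d (F x) (F y) <= s * d x y) ->
  exists2 x, A x & F x = x.
Proof.
move=> Xc Acl [x0 Ax0] s01 FA Fs; have /andP[s0 s1] := s01.
pose u n := iter n F x0.
have Au n : A (u n) by elim: n => [//|n IH]; exact: FA.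
have step n : d (u n) (F (u n)) <= s ^+ n * d x0 (F x0).
  elim: n => [|n IH]; first by rewrite expr0 mul1r.
  apply: (le_trans (Fs _ _ (Au n) (Au n.+1))).
  by rewrite exprS -mulrA ler_wpM2l.
(* Two points with small displacement are close, so the iterates are Cauchy without summing a
   geometric series. *)
have near_fixed x y : A x -> A y ->
    (1 - s) * d x y <= d x (F x) + d y (F y).
  move=> Ax Ay; have := Fs _ _ Ax Ay.
  have := metric_triangle x (F x) y; have := metric_triangle (F x) (F y) y.
  by rewrite (metric_sym (F y) y); lra.
have [|x Ax ux] := mcauchy_limit Xc Acl Au.
  move=> e e0.
  have [|N HN] := geometric_small (d x0 (F x0)) s01 (e := (1 - s) * e / 2).
    by rewrite divr_gt0 // mulr_gt0 // subr_gt0.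
  exists N => n m nN mN.
  rewrite -(ltr_pM2l (x := 1 - s)) ?subr_gt0 //.
  have := near_fixed _ _ (Au n) (Au m).
  have := step n; have := step m; have := HN n nN; have := HN m mN.
  by move=> *; lra.
exists x => //; apply/esym/mdist_positivity/eqP.
rewrite eq_le mdist_ge0 andbT; apply/ler_addgt0Pr => e e0.
have e30 : 0 < e / 3 by lra.
have [N1 H1] := ux _ e30.
have [N2 H2] := geometric_small (d x0 (F x0)) s01 e30.
pose n := (N1 + N2)%N.
have h1 : d (u n) x < e / 3 by apply: H1; rewrite /n; lia.
have h2 : s ^+ n * d x0 (F x0) < e / 3 by apply: H2; rewrite /n; lia.
have h3 := step n; have h4 := Fs _ _ (Au n) Ax.
have h5 := metric_triangle x (u n) (F x).
have h6 := metric_triangle (u n) (F (u n)) (F x).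
have h7 := metric_sym x (u n); have h8 := mdist_ge0 (u n) x.
have h9 : s * d (u n) x <= d (u n) x by rewrite ler_piMl // ltW.
by lra.
Qed.

End Contractions.

(** * Geodesically bounded sets: directional curves and fixed points *)

Section BoundedSets.
Context {R : realType} {X : metricType R}.
Local Notation d := (@mdist R X).
Variables (delta : R) (A : set X).
Hypotheses (X_complete : complete_metric X) (X_CAT0 : CAT0_space X).
Hypotheses (delta_ge0 : 0 <= delta) (X_hyp : hyperbolic_space X delta).
Hypotheses (A_closed : closed A) (A_convex : geodesically_convex A).
Hypothesis A_bounded : geodesically_bounded A.

Lemma bounded_gromov_products (o : X) (x : nat -> X) :
  A o -> (forall n, A (x n)) ->
  ~ (forall K : R, exists N, forall n m, (N <= n)%N -> (n <= m)%N ->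
     K <= gromov_product o (x n) (x m)).
Proof.
move=> Ao Ax xoo.
apply: (ray_from_gromov_products X_complete X_CAT0 delta_ge0 X_hyp A_closed
  A_convex Ao Ax) A_bounded => K.
have [N HN] := xoo K; exists N => n m nN mN.
have [nm|mn] := leqP n m; first exact: HN.
by rewrite gromov_product_sym; apply: HN => //; exact: ltnW.
Qed.

(** Based at [g 0], the Gromov product of the points at times [n <= m] is at least [n - b]. *)
Lemma bounded_directionally_bounded : directionally_bounded A.
Proof.
case=> g [b b0 hb] gA.
have Ag r : 0 <= r -> A (g r).
  by move=> r0; apply: gA; exists r; rewrite //= in_itv /= r0.
have n0 n : 0 <= n%:R :> R by exact: ler0n.
apply: (@bounded_gromov_products (g 0) (fun n => g n%:R)).
- exact: Ag.
- by move=> n; exact: Ag.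
move=> K; have [N HN] := nat_above (K + b).
exists N => n m nN nm.
have Nn : N%:R <= n%:R :> R by rewrite ler_nat.
have nm' : n%:R <= m%:R :> R by rewrite ler_nat.
have := hb 0 n%:R (lexx _) (n0 n); have := hb 0 m%:R (lexx _) (n0 m).
have := hb n%:R m%:R (n0 n) (n0 m); rewrite /gromov_product.
rewrite !sub0r !normrN !(ger0_norm (n0 _)) (distrC n%:R m%:R) ger0_norm ?subr_ge0 //.
by move=> *; lra.
Qed.

Section NonexpansiveMap.
Variables (T : X -> X) (p : X).
Hypotheses (T_ne : nonexpansive_on A T) (Ap : A p).

(** Sending [x] to the point at fraction [s] of [p, T x] is an [s]-contraction of [A], by
    [CN_two_points] with equal parameters. *)
Lemma resolvent_exists (s : R) : 0 <= s < 1 ->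
  exists x, A x /\ between p (T x) s x.
Proof.
move=> s01; have s01' : 0 <= s <= 1 by case/andP: s01 => -> /ltW.
have /choice[F hF] : forall x, exists y, between p (T x) s y.
  by move=> x; exact: between_exists.
have [||||x Ax Fx] := @contraction_fixed_point R X A F s X_complete A_closed.
- by exists p.
- by [].
- move=> x Ax.
  exact: (between_convex X_CAT0 A_convex Ap (T_ne.1 _ Ax) s01' (hF x)).
- move=> x y Ax Ay.
  have h := CN_two_points X_CAT0 s01' s01' (hF x) (hF y).
  have s0 : 0 <= s by case/andP: s01.
  apply: (@le_trans _ _ (s * d (T x) (T y))).
    rewrite -ler_sqr ?nnegrE ?mdist_ge0 //; last exact: mulr_ge0 s0 (mdist_ge0 _ _).
    by apply: (le_trans h); rewrite subrr; nra.
  by rewrite ler_wpM2l // T_ne.2.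
by exists x; split => //; rewrite -{2}Fx.
Qed.

(** Nonexpansiveness absorbs the term in [d (T x) (T y)], leaving
    [(1 - s * t) * D ^+ 2 <= (t - s) * W]. Since [t - s <= (1 - s * t) * t], this gives
    [D ^+ 2 <= t * W], and [s * t * P ^+ 2] is at least [d p x ^+ 2]. *)
Lemma resolvent_dist (s t : R) (x y : X) : 0 < s -> s < t -> t < 1 ->
  A x -> A y -> between p (T x) s x -> between p (T y) t y ->
  d x y ^+ 2 <= d p y ^+ 2 - d p x ^+ 2.
Proof.
move=> s0 st t1 Ax Ay hx hy.
have s01 : 0 <= s <= 1 by lra.
have t01 : 0 <= t <= 1 by lra.
have := CN_two_points X_CAT0 s01 t01 hx hy.
have := T_ne.2 _ _ Ax Ay; have := mdist_ge0 (T x) (T y).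
case: hx => -> _; case: hy => -> _.
move: (d (T x) (T y)) (d x y) (d p (T x)) (d p (T y)) => E D P Q E0 ED h.
have h1 : E ^+ 2 <= D ^+ 2 by nra.
have st0 : 0 <= s * t by nra.
have st1 : 0 < 1 - s * t by nra.
have h2 := ler_wpM2l st0 h1.
set W := t * Q ^+ 2 - s * P ^+ 2.
have h3 : (1 - s * t) * D ^+ 2 <= (t - s) * W by rewrite /W; nra.
have W0 : 0 <= W.
  rewrite -(pmulr_rge0 (x := t - s)) ?subr_gt0 //.
  apply: le_trans h3; exact: mulr_ge0 (ltW st1) (sqr_ge0 _).
have h4 : (t - s) * W <= (1 - s * t) * (t * W).
  rewrite mulrA ler_wpM2r //; nra.
have h5 : D ^+ 2 <= t * W.
  by rewrite -(ler_pM2l st1); exact: le_trans h3 h4.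
apply: (le_trans h5).
have : s * (t - s) * P ^+ 2 >= 0.
  by apply: mulr_ge0 (sqr_ge0 _); apply: mulr_ge0; lra.
by rewrite /W; nra.
Qed.

Lemma bounded_has_fixed_point : exists2 x, A x & T x = x.
Proof.
(* These parameters increase to 1; starting at 1/2 lets [d p (T (x n))] be bounded by twice
   [d p (x n)]. *)
pose s n : R := 1 - n.+2%:R^-1.
have inv0 n : 0 < n.+2%:R^-1 :> R by rewrite invr_gt0.
have invhalf n : n.+2%:R^-1 <= 2^-1 :> R by rewrite lef_pV2 ?posrE // ler_nat.
have s0 n : 1 / 2 <= s n by rewrite /s; move: (_^-1) (invhalf n) => i hi; lra.
have s1 n : s n < 1 by rewrite /s; move: (_^-1) (inv0 n) => i hi; lra.
have smono n m : (n < m)%N -> s n < s m.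
  by move=> nm; rewrite /s ltrD2l ltrN2 ltf_pV2 ?posrE // ltr_nat.
have /choice[x hx] : forall n, exists x, A x /\ between p (T x) (s n) x.
  by move=> n; apply: resolvent_exists; have := s0 n; have := s1 n; lra.
have Ax n : A (x n) by case: (hx n).
have key n m : (n <= m)%N ->
    d (x n) (x m) ^+ 2 <= d p (x m) ^+ 2 - d p (x n) ^+ 2.
  rewrite leq_eqVlt => /orP[/eqP->|nm]; first by rewrite mdistxx subrr expr0n.
  have [_ bn] := hx n; have [_ bm] := hx m.
  by apply: (resolvent_dist _ (smono _ _ nm)) bn bm => //; have := s0 n; lra.
have mono n m : (n <= m)%N -> d p (x n) <= d p (x m).
  move=> /key h; rewrite -ler_sqr ?nnegrE ?mdist_ge0 //.
  by have := sqr_ge0 (d (x n) (x m)); lra.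
(* If unbounded, [key] gives [d (x n) (x m) <= d p (x m)], so the product based at [p] is at least
   [d p (x n) / 2], which diverges. If bounded, the squared distances to [p] converge and [key]
   makes [x] Cauchy. *)
have [[B HB]|unb] := pselect (exists B, forall n, d p (x n) <= B); last first.
  exfalso; apply: (bounded_gromov_products Ap Ax) => K.
  have [N HN] : exists N, 2 * K <= d p (x N).
    apply: contrapT => h; apply: unb; exists (2 * K) => n.
    by rewrite leNgt; apply/negP => /ltW h'; apply: h; exists n.
  exists N => n m nN nm; rewrite /gromov_product.
  have h1 := mono _ _ nN.
  have h2 : d (x n) (x m) <= d p (x m).
    rewrite -ler_sqr ?nnegrE ?mdist_ge0 //.
    by have := key _ _ nm; have := sqr_ge0 (d p (x n)); lra.
  by lra.
have B0 : 0 <= B := le_trans (mdist_ge0 _ _) (HB 0%N).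
pose E := [set d p (x n) ^+ 2 | n in [set: nat]].
have Esup : has_sup E.
  split; first by exists (d p (x 0%N) ^+ 2), 0%N.
  by exists (B ^+ 2) => _ [n _ <-]; rewrite ler_sqr ?nnegrE ?mdist_ge0.
have Ele n : d p (x n) ^+ 2 <= sup E by apply: (ub_le_sup Esup.2); exists n.
have [|y Ay xy] := mcauchy_limit X_complete A_closed Ax.
  move=> e e0.
  have [_ [N _ <-] HN] := sup_adherent (exprn_gt0 2 e0) Esup.
  have close n m : (N <= n)%N -> (n <= m)%N -> d (x n) (x m) < e.
    move=> nN nm; rewrite -ltr_sqr ?nnegrE ?mdist_ge0 // ?(ltW e0) //.
    have := key _ _ nm; have := Ele m; have := mono _ _ nN.
    by rewrite -ler_sqr ?nnegrE ?mdist_ge0 // => *; lra.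
  exists N => n m nN mN; have [nm|mn] := leqP n m; first exact: close.
  by rewrite metric_sym; apply: close => //; exact: ltnW.
exists y => //; apply/esym/mdist_positivity/eqP.
rewrite eq_le mdist_ge0 andbT; apply/ler_addgt0Pr => e e0.
have e30 : 0 < e / 3 by lra.
have [N1 H1] := xy _ e30.
have [N2 H2] := nat_above (2 * B / (e / 3)).
pose n := (N1 + N2)%N.
have h1 : d (x n) y < e / 3 by apply: H1; rewrite /n; lia.
have h2 := T_ne.2 _ _ (Ax n) Ay.
have h3 : d (x n) (T (x n)) <= e / 3.
  have [_ [b1 ->]] := hx n.
  have TB : d p (T (x n)) <= 2 * B.
    have := HB n; rewrite b1 => h; have := mdist_ge0 p (T (x n)); have := s0 n.
    by nra.
  have -> : 1 - s n = n.+2%:R^-1 by rewrite /s opprB addrC subrK.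
  rewrite mulrC ler_pdivrMr ?ltr0n //; apply: (le_trans TB).
  rewrite -ler_pdivrMl // mulrC; apply: (le_trans (ltW H2)).
  by rewrite ler_nat /n; lia.
have := metric_triangle y (x n) (T y); have := metric_triangle (x n) (T (x n)) (T y).
have := metric_sym y (x n).
by move=> *; lra.
Qed.

End NonexpansiveMap.

End BoundedSets.

(** * From local to global: chains almost geodesic over two steps *)

Section LocalToGlobal.
Context {R : realType} {X : metricType R}.
Local Notation d := (@mdist R X).
Variables (delta : R) (y : nat -> X) (l : R).
Hypotheses (delta_ge0 : 0 <= delta) (X_hyp : hyperbolic_space X delta).
Hypotheses (l_large : 12 * delta + 4 <= l).
Hypotheses (y_step : forall j, l - 1 <= d (y j) (y j.+1) <= l).
Hypotheses (y_step2 : forall j, 2 * l - 1 <= d (y j) (y j.+2)).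

(** In the four-point condition at [y n.+1], the product of [y n.+2] with the far point is at least
    [l - 3 / 2 - 3 * delta] by induction, too large for the second alternative. The bound therefore
    does not accumulate. *)
Lemma chain_forward_product k n :
  gromov_product (y n.+1) (y n) (y (n + k).+2) <= 1 / 2 + 3 * delta.
Proof.
have dge0 := delta_ge0; have lge := l_large.
have base j : gromov_product (y j.+1) (y j) (y j.+2) <= 1 / 2.
  have := y_step j; have := y_step j.+1; have := y_step2 j.
  by rewrite /gromov_product (metric_sym (y j.+1) (y j)) => *; lra.
elim: k n => [|k IH] n; first by rewrite addn0; have := base n; lra.
have h := IH n.+1; rewrite addSnnS in h.
have hb := base n; have hs := y_step n.+1.
have := four_point X_hyp (y n.+1) (y n) (y (n + k.+1).+2) (y n.+2).
rewrite (gromov_product_sym _ (y (n + k.+1).+2)) (gromov_product_base _ (y n.+2)).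
by case=> h'; lra.
Qed.

(** Prepending a step adds its length minus twice the forward product, which is at least 1 by the
    choice of [l]. *)
Lemma chain_dist k n : k%:R <= d (y n) (y (n + k)).
Proof.
have dge0 := delta_ge0; have lge := l_large.
elim: k n => [|k IH] n; first by rewrite mdist_ge0.
have hs := y_step n; rewrite -natr1.
case: k IH => [|k] IH; first by rewrite addn1; lra.
have := IH n.+1; rewrite addSnnS -addSnnS.
have := chain_forward_product k n; rewrite /gromov_product !addnS.
by rewrite (metric_sym (y n.+1) (y n)) addSn => *; lra.
Qed.

(** At [y n.+2], the product of [y n.+1] and [y 0] is at least [l - 3 / 2 - 6 * delta] by induction,
    so the four-point condition compares [y 0] and [y m] with the forward product. This uses the
    full [12 * delta] in [l]. *)
Lemma chain_backward_product n m : (n.+1 < m)%N ->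
  gromov_product (y n.+1) (y 0%N) (y m) <= 1 / 2 + 6 * delta.
Proof.
have dge0 := delta_ge0; have lge := l_large.
have forward i j : (i.+1 < j)%N ->
    gromov_product (y i.+1) (y i) (y j) <= 1 / 2 + 3 * delta.
  move=> ij; have := chain_forward_product (j - i.+2) i.
  by rewrite -addSn -addSn subnKC.
elim: n m => [|n IH] m nm; first by have := forward _ _ nm; lra.
have h1 := IH n.+2 (leqnn _); have h2 := forward _ _ nm; have hs := y_step n.+1.
have := four_point X_hyp (y n.+2) (y n.+1) (y 0%N) (y m).
rewrite (gromov_product_base (y n.+2) (y n.+1) (y 0%N)).
rewrite (gromov_product_sym (y n.+1) (y n.+2)) (metric_sym (y n.+2) (y n.+1)).
by case=> h'; lra.
Qed.

Lemma chain_product n m : (0 < n)%N -> (n <= m)%N ->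
  n%:R - 1 / 2 - 6 * delta <= gromov_product (y 0%N) (y n) (y m).
Proof.
have dge0 := delta_ge0; case: n => // n _.
have := chain_dist n.+1 0; rewrite add0n.
rewrite leq_eqVlt => h /orP[/eqP<-|nm].
  by rewrite /gromov_product mdistxx; lra.
by rewrite gromov_product_base; have := chain_backward_product nm; lra.
Qed.

End LocalToGlobal.

(** * The Lion-Man game in a geodesically bounded set *)

Section LionManPlay.
Context {R : realType} {X : metricType R}.
Local Notation d := (@mdist R X).
Variables (delta : R) (A : set X).
Hypotheses (X_complete : complete_metric X) (X_CAT0 : CAT0_space X).
Hypotheses (delta_ge0 : 0 <= delta) (X_hyp : hyperbolic_space X delta).
Hypotheses (A_closed : closed A) (A_convex : geodesically_convex A).
Hypothesis A_bounded : geodesically_bounded A.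
Variables (D : R) (L M : nat -> X).
Hypotheses (D_gt0 : 0 < D) (LM_play : lion_man_play A D L M).

Lemma lion_in n : A (L n).
Proof.
have [AL AM play] := LM_play.
have AMn k : A (M k) by case: k => [//|k]; case: (play k).
elim: n => [//|n IH]; have [[S hS SL] _ _ _] := play n.
exact: (A_convex IH (AMn n) hS SL).
Qed.

Lemma lion_step n : d (L n) (L n.+1) = Num.min D (d (L n) (M n)) /\
  d (L n.+1) (M n) = d (L n) (M n) - Num.min D (d (L n) (M n)).
Proof.
have [_ _ play] := LM_play; have [[S hS SL] h _ _] := play n.
by have := segment_add hS SL; rewrite h => h'; split=> //; lra.
Qed.

Lemma man_step n : d (M n) (M n.+1) <= D.
Proof. by have [_ _ /(_ n)[]] := LM_play. Qed.

Lemma man_steps n k : d (M n) (M (n + k)) <= k%:R * D.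
Proof.
elim: k => [|k IH]; first by rewrite addn0 mdistxx mul0r.
rewrite addnS -natr1 mulrDl mul1r.
apply: le_trans (metric_triangle _ (M (n + k)) _) _.
exact: lerD IH (man_step _).
Qed.

Lemma lion_steps n k : d (L n) (L (n + k)) <= k%:R * D.
Proof.
elim: k => [|k IH]; first by rewrite addn0 mdistxx mul0r.
rewrite addnS -natr1 mulrDl mul1r.
apply: le_trans (metric_triangle _ (L (n + k)) _) _.
by apply: lerD IH _; rewrite (lion_step _).1 ge_min lexx.
Qed.

(** From then on each move of the lion lands on the man's current position, and the man's reply
    reopens a gap of at most [D]. *)
Lemma lion_wins_close n : d (L n) (M n) <= D -> lion_wins L M.
Proof.
move=> hn.
have close k : d (L (n + k)) (M (n + k)) <= D.
  elim: k => [|k IH]; first by rewrite addn0.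
  rewrite addnS; have [_] := lion_step (n + k); rewrite min_r // subrr => h.
  have := metric_triangle (L (n + k).+1) (M (n + k)) (M (n + k).+1).
  by have := man_step (n + k); lra.
apply/cvgrPdist_lt => e e0; exists n => // m /= nm.
have [_ ->] := lion_step m.
by have := close (m - n)%N; rewrite subnKC // => h; rewrite min_r // subrr subr0 normr0.
Qed.

(** * A man who keeps a gap of at least D + c *)

Section EscapingMan.
Variable c : R.
Hypotheses (c_gt0 : 0 < c) (gap_ge : forall n, D + c <= d (L n) (M n)).

Lemma far_lion_step n : d (L n) (L n.+1) = D /\
  d (L n.+1) (M n) = d (L n) (M n) - D.
Proof.
have cgt0 := c_gt0; have [-> ->] := lion_step n; rewrite min_l //.
by have := gap_ge n; lra.
Qed.

Lemma gap_nonincreasing n m : (n <= m)%N -> d (L m) (M m) <= d (L n) (M n).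
Proof.
move=> /subnKC <-; elim: (m - n)%N => [|k IH]; first by rewrite addn0.
rewrite addnS; apply: le_trans IH.
have [_ h] := far_lion_step (n + k).
have := metric_triangle (L (n + k).+1) (M (n + k)) (M (n + k).+1).
by have := man_step (n + k); lra.
Qed.

Lemma gap_limit : exists2 alpha, D + c <= alpha &
  (forall n, alpha <= d (L n) (M n)) /\
  forall e, 0 < e -> exists N, forall n, (N <= n)%N -> d (L n) (M n) <= alpha + e.
Proof.
pose E := [set d (L n) (M n) | n in [set: nat]].
have Einf : has_inf E.
  split; first by exists (d (L 0%N) (M 0%N)), 0%N.
  by exists (D + c) => _ [n _ <-].
exists (inf E).
  by apply: lb_le_inf; [exact: Einf.1|move=> _ [n _ <-]].
split=> [n|e e0]; first by apply: (ge_inf Einf.2); exists n.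
have [_ [N _ <-] HN] := inf_adherent e0 Einf.
exists N => n nN; exact: le_trans (gap_nonincreasing nN) (ltW HN).
Qed.

(* Equality holds asymptotically when both players run along one geodesic. The
   lion's step is a fixed fraction of [L n, M n], so convexity of the distance
   to M (n + k + 1) transports the bound from L (n + 1) back to L n. *)
Lemma man_ahead (alpha : R) (k : nat) : D + c <= alpha ->
  (forall n, alpha <= d (L n) (M n)) ->
  (forall e, 0 < e -> exists N, forall n, (N <= n)%N ->
     d (L n) (M n) <= alpha + e) ->
  forall e, 0 < e -> exists N, forall n, (N <= n)%N ->
    alpha + k%:R * D - e <= d (L n) (M (n + k)).
Proof.
move=> ca alpha_le gap_cvg; have Dgt0 := D_gt0; have cgt0 := c_gt0.
elim: k => [|k IH] e e0.
  exists 0%N => n _; rewrite mul0r addr0 addn0.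
  by have := alpha_le n; lra.
have ce : 0 < c * e by exact: mulr_gt0.
have al0 : 0 < alpha + 1 by lra.
(* With [a] the gap, the errors [eps * a] and [D * (a - alpha)] must together stay below
   [(a - D) * e], which is at least [c * e]. Each is allotted half, using [a <= alpha + 1] for the
   first. *)
have [|N1 H1] := IH (c * e / (2 * (alpha + 1))).
  by rewrite divr_gt0 // mulr_gt0.
have [|N2 H2] := gap_cvg (Num.min 1 (c * e / (2 * D))).
  by rewrite lt_min ltr01 divr_gt0 // mulr_gt0.
exists (N1 + N2)%N => n nN.
have h1 : alpha + k%:R * D - c * e / (2 * (alpha + 1)) <=
    d (L n.+1) (M (n.+1 + k)) by apply: H1; lia.
have h2 : d (L n) (M n) <= alpha + Num.min 1 (c * e / (2 * D)) by apply: H2; lia.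
have a1 : d (L n) (M n) <= alpha + 1.
  by apply: (le_trans h2); rewrite lerD2l ge_min lexx.
have a2 : d (L n) (M n) <= alpha + c * e / (2 * D).
  by apply: (le_trans h2); rewrite lerD2l ge_min lexx orbT.
have a3 := alpha_le n.
have man := man_steps n k.+1.
move: h1; rewrite addSnnS; set z := M (n + k.+1) in man *; set eps := _ / _ => h1.
set a := d (L n) (M n) in a1 a2 a3 *.
have a0 : 0 < a by lra.
have t01 : 0 <= D / a <= 1.
  by rewrite (divr_ge0 (ltW Dgt0) (ltW a0)) /= ler_pdivrMr // mul1r; lra.
have bt : between (L n) (M n) (D / a) (L n.+1).
  have [b1 b2] := far_lion_step n.
  by split; rewrite ?b1 ?b2 -/a; field; rewrite gt_eqF.
have := dist_convex X_CAT0 z t01 bt.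
rewrite (metric_sym z (L n)) (metric_sym z (M n)) (metric_sym z (L n.+1)).
move=> /(ler_wpM2l (ltW a0)).
have -> : a * ((1 - D / a) * d (L n) z + D / a * d (M n) z) =
    (a - D) * d (L n) z + D * d (M n) z by field; rewrite gt_eqF.
move=> conv.
have epsE : eps * (2 * (alpha + 1)) = c * e.
  by rewrite /eps divfK // gt_eqF // mulr_gt0.
have eps0 : 0 < eps by rewrite /eps divr_gt0 // mulr_gt0.
have etaD : 2 * D * (a - alpha) <= c * e.
  rewrite mulrC -ler_pdivlMr ?mulr_gt0 //; lra.
have b1 : a * (alpha + k%:R * D - eps) <= (a - D) * d (L n) z + D * (k.+1%:R * D).
  apply: (le_trans (ler_wpM2l (ltW a0) h1)); apply: (le_trans conv).
  by rewrite lerD2l ler_wpM2l // ltW.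
have b2 : eps * a <= eps * (alpha + 1) by rewrite ler_wpM2l // (ltW eps0).
have b3 : c * e <= (a - D) * e by rewrite (ler_wpM2r (ltW e0)) //; lra.
have aD : 0 < a - D by lra.
rewrite leNgt; apply/negP; rewrite -(ltr_pM2l aD).
have kS : k.+1%:R = k%:R + 1 :> R by rewrite natr1.
rewrite kS in b1 *.
by nra.
Qed.

(** After [k] rounds the man is almost [alpha + k%:R * D] away from [L n] but only about [alpha]
    from the lion; the two errors of 1/2 add up to 1. *)
Lemma lion_almost_geodesic (k : nat) : exists N, forall n, (N <= n)%N ->
  k%:R * D - 1 <= d (L n) (L (n + k)).
Proof.
have [alpha ca [al gap]] := gap_limit.
have e0 : 0 < 1 / 2 :> R by lra.
have [N1 H1] := man_ahead k ca al gap e0.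
have [N2 H2] := gap _ e0.
exists (N1 + N2)%N => n nN.
have h1 : alpha + k%:R * D - 1 / 2 <= d (L n) (M (n + k)) by apply: H1; lia.
have h2 : d (L (n + k)) (M (n + k)) <= alpha + 1 / 2 by apply: H2; lia.
have := metric_triangle (L n) (L (n + k)) (M (n + k)); lra.
Qed.

Lemma man_cannot_escape : False.
Proof.
have dge0 := delta_ge0; have Dgt0 := D_gt0.
have [k hk] := nat_above ((12 * delta + 4) / D).
have lk : 12 * delta + 4 <= k%:R * D by rewrite -ler_pdivrMr // ltW.
have [N1 H1] := lion_almost_geodesic k.
have [N2 H2] := lion_almost_geodesic (k + k).
(* Sampling every [k] rounds makes the steps long enough for the local-to-global chain; the offset
   makes both estimates valid from the first sample. *)
pose y j := L (N1 + N2 + j * k)%N.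
have yS j : y j.+1 = L (N1 + N2 + j * k + k)%N.
  by rewrite /y mulSn; congr L; lia.
have ySS j : y j.+2 = L (N1 + N2 + j * k + (k + k))%N.
  by rewrite /y !mulSn; congr L; lia.
have step j : k%:R * D - 1 <= d (y j) (y j.+1) <= k%:R * D.
  by rewrite yS lion_steps andbT; apply: H1; lia.
have step2 j : 2 * (k%:R * D) - 1 <= d (y j) (y j.+2).
  have := H2 (N1 + N2 + j * k)%N; rewrite -ySS natrD => h.
  have := h ltac:(lia); rewrite -/(y j); lra.
apply: (@bounded_gromov_products _ _ delta A X_complete X_CAT0 delta_ge0 X_hyp
  A_closed A_convex A_bounded (y 0%N) y).
- exact: lion_in.
- by move=> n; exact: lion_in.
move=> K; have [N HN] := nat_above (K + 1 / 2 + 6 * delta).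
exists N.+1 => n m nN nm.
have := chain_product delta_ge0 X_hyp lk step step2 (leq_ltn_trans (leq0n N) nN) nm.
have : N%:R <= n%:R :> R by rewrite ler_nat ltnW.
by lra.
Qed.

End EscapingMan.

(** While the gap exceeds [D], the distance left after the lion's move is the gap minus [D]. The gap
    is nonincreasing and cannot stay above [D + e], so this distance tends to 0. *)
Lemma bounded_lion_wins : lion_wins L M.
Proof.
have [[n hn]|far] := pselect (exists n, d (L n) (M n) <= D).
  exact: lion_wins_close hn.
have gapD n : D < d (L n) (M n).
  by rewrite ltNge; apply/negP => h; apply: far; exists n.
have step n : d (L n.+1) (M n) = d (L n) (M n) - D.
  by have [_ ->] := lion_step n; rewrite min_l // ltW.
have mono n : d (L n.+1) (M n.+1) <= d (L n) (M n).
  have := metric_triangle (L n.+1) (M n) (M n.+1).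
  by have := man_step n; rewrite step; lra.
apply/cvgrPdist_lt => e e0.
have [n hn] : exists n, d (L n) (M n) < D + e.
  apply: contrapT => h; apply: (man_cannot_escape e0) => n.
  by rewrite leNgt; apply/negP => h'; apply: h; exists n.
exists n => // m /= /subnKC <-.
rewrite sub0r normrN step ger0_norm; last by rewrite subr_ge0 ltW.
suff : d (L (n + (m - n))) (M (n + (m - n))) <= d (L n) (M n) by lra.
elim: (m - n)%N => [|k IH]; first by rewrite addn0.
by rewrite addnS; exact: le_trans (mono _) IH.
Qed.

End LionManPlay.

(** * The equivalence *)

Lemma fixed_point_approximate (R : realType) (X : metricType R) (A : set X) :
  fixed_point_property A -> approximate_fixed_point_property A.
Proof.
move=> fpp T T_ne; have [x Ax Tx] := fpp T T_ne.
have lb : lbound [set mdist y (T y) | y in A] 0.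
  by move=> _ [y _ <-]; exact: mdist_ge0.
apply/eqP; rewrite eq_le; apply/andP; split.
  by apply: ge_inf; [exists 0 | exists x => //; rewrite Tx mdistxx].
by apply: lb_le_inf lb; exists (mdist x (T x)), x.
Qed.

Theorem theorem4p3 (R : realType) (X : metricType R) (delta : R) (A : set X)
    (X_complete : complete_metric X) (X_CAT0 : CAT0_space X)
    (delta_ge0 : 0 <= delta) (X_hyperbolic : hyperbolic_space X delta)
    (A_nonempty : A !=set0) (A_closed : closed A)
    (A_convex : geodesically_convex A) :
  [<-> geodesically_bounded A;
       directionally_bounded A;
       approximate_fixed_point_property A;
       fixed_point_property A;
       lion_always_wins A].
Proof.
have dir_bounded : directionally_bounded A -> geodesically_bounded A.
  by move=> h [g g_ray gA]; exact: (ray_not_directionally_bounded g_ray gA h).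
have afpp_bounded : approximate_fixed_point_property A -> geodesically_bounded A.
  move=> h [g g_ray gA].
  exact: (ray_not_approximate_fixed_point g_ray gA A_nonempty h).
have fpp_bounded : fixed_point_property A -> geodesically_bounded A.
  by move=> h [g g_ray gA]; exact: (ray_not_fixed_point g_ray gA h).
have lion_bounded : lion_always_wins A -> geodesically_bounded A.
  by move=> h [g g_ray gA]; exact: (ray_not_lion_always_wins g_ray gA h).
have bounded_fpp : geodesically_bounded A -> fixed_point_property A.
  move=> bA T T_ne; have [p Ap] := A_nonempty.
  exact: (bounded_has_fixed_point X_complete X_CAT0 delta_ge0 X_hyperbolic
    A_closed A_convex bA T_ne Ap).
(* Each other condition implies geodesic boundedness, so the links of the cycle are routed through
   it. *)
tfae.
- exact: (bounded_directionally_bounded X_complete X_CAT0 delta_ge0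
    X_hyperbolic A_closed A_convex).
- by move=> /dir_bounded/bounded_fpp; exact: fixed_point_approximate.
- by move=> /afpp_bounded/bounded_fpp.
- move=> /fpp_bounded bA D L M D_gt0 play.
  exact: (bounded_lion_wins X_complete X_CAT0 delta_ge0 X_hyperbolic A_closed
    A_convex bA D_gt0 play).
- exact: lion_bounded.
Qed.
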